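(* Let $(T,\leq,C_0,C_1,\ldots)$ be a countable $\aleph_0$-categorical coloured tree. Then every maximal chain $L$ of $T$, equipped with the order and the colour predicates restricted from $T$, is an $\aleph_0$-categorical coloured linear order.
   Context: A tree is a partial order $(T,\leq)$ such that for all $x,y,z$, if $x,y\leq z$ then $x\leq y$ or $y\leq x$, and for all $x,y$ there is $z$ with $z\leq x,y$. A coloured tree is a tree together with mutually exclusive unary predicates $C_i$ (colours). A countable structure is $\aleph_0$-categorical if it is the unique countable model of its first-order theory (equivalently, its automorphism group has finitely many orbits on $n$-tuples for each $n$). *)

(* Defs.v *)
From Stdlib Require Import Relation_Definitions.
From mathcomp Require Import all_boot.
From mathcomp Require Import boolp classical_sets functions cardinality.

Set Implicit Arguments.
Unset Strict Implicit.
Unset Printing Implicit Defensive.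

Local Open Scope classical_set_scope.

(* Arbitrary structures for the language with equality, one binary relation
   symbol and unary relation symbols C_i (i : I).  No axiom is imposed here:
   models of a theory range over this type. *)
Record structure (I : Type) := Structure {
  carrier :> Type;
  le : relation carrier;
  colour : I -> carrier -> Prop
}.
Arguments le {I M} : rename.
Arguments colour {I M} : rename.

(* [formula I n] : first-order formulas with free variables among 'I_n.
   [All] binds the variable 0 of its body, the variable i of the context
   becoming i.+1 (see [sat]).  The other connectives and the existential
   quantifier are definable, satisfaction being classical. *)
Inductive formula (I : Type) : nat -> Type :=
| Eq n (i j : 'I_n) : formula I n
| Le n (i j : 'I_n) : formula I n
| Col n (c : I) (i : 'I_n) : formula I n
| Bot n : formula I n
| Imp n (phi psi : formula I n) : formula I n
| All n (phi : formula I n.+1) : formula I n.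

Fixpoint sat (I : Type) (M : structure I) n (phi : formula I n) :
    n.-tuple M -> Prop :=
  match phi in formula _ m return m.-tuple M -> Prop with
  | Eq _ i j => fun v => tnth v i = tnth v j
  | Le _ i j => fun v => le (tnth v i) (tnth v j)
  | Col _ c i => fun v => colour c (tnth v i)
  | Bot _ => fun=> False
  | Imp _ phi psi => fun v => sat phi v -> sat psi v
  | All _ phi => fun v => forall x : M, sat phi [tuple of x :: v]
  end.

Definition sentence (I : Type) := formula I 0.

Definition theory (I : Type) (M : structure I) : set (sentence I) :=
  [set phi | sat phi [tuple of [::] : seq M]].

Definition models (I : Type) (N : structure I) (Th : set (sentence I)) : Prop :=
  Th `<=` theory N.

Definition isomorphic (I : Type) (M N : structure I) : Prop :=
  exists f : M -> N,
    [/\ bijective f,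
        forall x y : M, le x y <-> le (f x) (f y)
      & forall (c : I) (x : M), colour c x <-> colour c (f x)].

(* [countable] means finite or countably infinite. *)
Definition aleph0_categorical (I : Type) (M : structure I) : Prop :=
  countable [set: M] /\
  forall N : structure I,
    countable [set: N] -> models N (theory M) -> isomorphic M N.

Definition exclusive_colours (I : Type) (M : structure I) : Prop :=
  forall (i j : I) (x : M), colour i x -> colour j x -> i = j.

Definition tree_order (X : Type) (R : relation X) : Prop :=
  [/\ Relation_Definitions.order X R,
      forall x y z, R x z -> R y z -> R x y \/ R y x
    & forall x y, exists z, R z x /\ R z y].

Definition coloured_tree (I : Type) (M : structure I) : Prop :=
  tree_order (@le I M) /\ exclusive_colours M.

Definition coloured_linear_order (I : Type) (M : structure I) : Prop :=
  [/\ Relation_Definitions.order M le, total_on [set: M] le & exclusive_colours M].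

Definition maximal_chain (X : Type) (R : relation X) (L : set X) : Prop :=
  total_on L R /\ forall A : set X, total_on A R -> L `<=` A -> A = L.

Definition induced (I : Type) (M : structure I) (L : set M) : structure I :=
  @Structure I L
    (fun x y => le (val x) (val y))
    (fun c x => colour c (val x)).

(* Main.v *)
(* Ryll-Nardzewski: if T is the only countable model of its theory, every type
   over the empty set is realised in T (ultrapower and Loewenheim-Skolem), so
   isolated types are dense by a diagonal argument against the countably many
   tuples of T; hence T has an atomic elementary submodel, T itself is atomic,
   and T has finitely many n-types for each n.  Conversely this finiteness
   implies aleph0-categoricity, by back and forth.

   A maximal chain L is downward closed, so the type in T of a pair a <= b of L
   controls the interval [a, b] of L.  An ultrafilter containing the final
   segments of L gives a cofinal set A of L and a pair type r such that every u
   in A has, arbitrarily high in L, a u' in A with tp(u, u') = r.  Consequently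
   the final segments [u, oo) of L with u in A all look alike, and the type in L
   of x_1 < ... < x_n is determined by the types in T of the pairs
   (x_i, x_{i+1}) and (x_n, u) for some u in A above x_n. *)
From HB Require Import structures.
Require Import Defs.
From mathcomp Require Import all_boot.
From mathcomp Require Import boolp classical_sets functions cardinality filter.

Set Implicit Arguments.
Unset Strict Implicit.
Unset Printing Implicit Defensive.

(** * Formulas *)

Section Formulas.
Variable I : Type.

Definition Neg n (phi : formula I n) := Imp phi (Bot I n).
Definition Conj n (phi psi : formula I n) := Neg (Imp phi (Neg psi)).
Definition Ex n (phi : formula I n.+1) := Neg (All (Neg phi)).
Definition Tru n := Neg (Bot I n).

Definition Bigconj n (K : finType) (F : K -> formula I n) :=
  foldr (fun k => Conj (F k)) (Tru n) (enum K).

Definition lift_var k n (s : 'I_k -> 'I_n) (i : 'I_k.+1) : 'I_n.+1 :=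
  oapp (fun j => lift ord0 (s j)) ord0 (unlift ord0 i).

Fixpoint rename k (phi : formula I k) :
    forall n, ('I_k -> 'I_n) -> formula I n :=
  match phi in formula _ k return forall n, ('I_k -> 'I_n) -> formula I n with
  | Eq _ i j => fun _ s => Eq I (s i) (s j)
  | Le _ i j => fun _ s => Le I (s i) (s j)
  | Col _ c i => fun _ s => Col c (s i)
  | Bot _ => fun n _ => Bot I n
  | Imp _ phi psi => fun _ s => Imp (rename phi s) (rename psi s)
  | All _ phi => fun _ s => All (rename phi (lift_var s))
  end.

Fixpoint Exs n k : formula I (n + k) -> formula I k :=
  if n is n'.+1 then fun phi => Exs (Ex (phi : formula I (n' + k).+1))
  else fun phi => phi.

Section Satisfaction.
Variable M : structure I.
Implicit Types n : nat.

Lemma satN n (phi : formula I n) (v : n.-tuple M) :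
  sat (Neg phi) v <-> ~ sat phi v.
Proof. by []. Qed.

Lemma satT n (v : n.-tuple M) : sat (Tru n) v.
Proof. by []. Qed.

Lemma satC n (phi psi : formula I n) (v : n.-tuple M) :
  sat (Conj phi psi) v <-> sat phi v /\ sat psi v.
Proof.
split=> /= [h|[h1 h2] h]; last exact: h.
by split; apply: contrapT => h1; apply: h => // h2 h3; apply: h1.
Qed.

Lemma satEx n (phi : formula I n.+1) (v : n.-tuple M) :
  sat (Ex phi) v <-> exists x, sat phi [tuple of x :: v].
Proof.
split=> /= [h|[x hx] h]; last exact: h hx.
by apply: contrapT => h1; apply: h => x hx; apply: h1; exists x.
Qed.

Lemma sat_bigconj n (K : finType) (F : K -> formula I n) (v : n.-tuple M) :
  sat (Bigconj F) v <-> forall k, sat (F k) v.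
Proof.
suff h s : sat (foldr (fun k => Conj (F k)) (Tru n) s) v <->
    {in s, forall k, sat (F k) v}.
  by rewrite /Bigconj h; split=> hF k => [|_]; apply: hF; rewrite // mem_enum.
elim: s => [|k s IH]; first by split=> _; [move=> k | exact: satT].
rewrite [foldr _ _ _]/= satC IH; split=> [[h1 h2] j|h].
  by rewrite inE => /predU1P[->|/h2].
by split=> [|j hj]; apply: h; rewrite inE ?eqxx // hj orbT.
Qed.

Lemma sat_rename k (phi : formula I k) n (s : 'I_k -> 'I_n) (v : n.-tuple M) :
  sat (rename phi s) v <-> sat phi [tuple tnth v (s i) | i < k].
Proof.
elim: phi n s v => {k} [k i j|k i j|k c i|k|k f IHf g IHg|k f IHf] n s v /=;
  rewrite ?tnth_mktuple //; first by rewrite IHf IHg.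
suff e x : [tuple tnth [tuple of x :: v] (lift_var s i) | i < k.+1] =
           [tuple of x :: [tuple tnth v (s i) | i < k]].
  by split=> h x; have := h x; rewrite IHf e.
apply: eq_from_tnth => i; rewrite tnth_mktuple /lift_var.
case: (unliftP ord0 i) => [j ->|->] /=; last by rewrite !tnth0.
by rewrite !tnthS tnth_mktuple.
Qed.

Lemma sat_exs n k (phi : formula I (n + k)) (v : k.-tuple M) :
  sat (Exs phi) v <-> exists w : n.-tuple M, sat phi [tuple of w ++ v].
Proof.
elim: n phi => [|n IH] phi /=.
  split=> [h|[w]]; first exists [tuple]; rewrite ?(tuple0 w) /=;
  by rewrite (_ : [tuple of _] = v) //; apply: val_inj.
rewrite IH; split=> [[w /satEx[x hx]]|[w hw]].
  exists [tuple of x :: w]; congr (sat phi _): hx; exact: val_inj.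
exists [tuple of behead w]; apply/satEx; exists (thead w).
congr (sat phi _): hw; apply: val_inj => /=.
by rewrite {1}(tuple_eta w).
Qed.

End Satisfaction.
End Formulas.

Section FormulaCountable.
Variable I : countType.

Fixpoint encode n (phi : formula I n) : GenTree.tree (I + nat) :=
  match phi with
  | Eq _ i j =>
      GenTree.Node 0 [:: GenTree.Leaf (inr (i : nat)); GenTree.Leaf (inr (j : nat))]
  | Le _ i j =>
      GenTree.Node 1 [:: GenTree.Leaf (inr (i : nat)); GenTree.Leaf (inr (j : nat))]
  | Col _ c i =>
      GenTree.Node 2 [:: GenTree.Leaf (inl c); GenTree.Leaf (inr (i : nat))]
  | Bot _ => GenTree.Node 3 [::]
  | Imp _ f g => GenTree.Node 4 [:: encode f; encode g]
  | All _ f => GenTree.Node 5 [:: encode f]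
  end.

(** Trees do not record the number of variables, so it is an argument, raised under the node of
    [All]. Ill-formed trees and out-of-range indices decode to [Bot]. *)
Fixpoint decode (t : GenTree.tree (I + nat)) n : formula I n :=
  match t with
  | GenTree.Node 0 [:: GenTree.Leaf (inr i); GenTree.Leaf (inr j)] =>
      if (insub i, insub j) is (Some i', Some j') then Eq I i' j' else Bot I n
  | GenTree.Node 1 [:: GenTree.Leaf (inr i); GenTree.Leaf (inr j)] =>
      if (insub i, insub j) is (Some i', Some j') then Le I i' j' else Bot I n
  | GenTree.Node 2 [:: GenTree.Leaf (inl c); GenTree.Leaf (inr i)] =>
      if insub i is Some i' then Col c i' else Bot I n
  | GenTree.Node 4 [:: t1; t2] => Imp (decode t1 n) (decode t2 n)
  | GenTree.Node 5 [:: t1] => All (decode t1 n.+1)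
  | _ => Bot I n
  end.

Lemma encodeK n : cancel (@encode n) (fun t => decode t n).
Proof.
elim=> {n} [n i j|n i j|n c i|n|n f IHf g IHg|n f IHf] //=; rewrite ?valK //.
  by rewrite IHf IHg.
by rewrite IHf.
Qed.

HB.instance Definition _ n := Countable.copy (formula I n) (can_type (@encodeK n)).

End FormulaCountable.

(** * Elementary submodels, ultrapowers, back and forth *)

(** Dependent choice with bookkeeping, used both for Loewenheim-Skolem and for back and forth: every
    request of [R] is met at arbitrarily late stages. Stages are kept newest first, hence the
    [rev]. *)
Lemma generic_sequence (X : Type) (R : countType) (r0 : R) (P : seq X -> Prop)
    (Q : R -> seq X -> X -> Prop) :
  P [::] ->
  (forall s r, P s -> exists x, P (x :: s) /\ Q r s x) ->
  exists f : nat -> X, (forall n, P (rev (mkseq f n))) /\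
    forall r m, exists n, m <= n /\ Q r (rev (mkseq f n)) (f n).
Proof.
move=> P0 PS.
(* Each request is treated at all the stages with a given 2-adic valuation. *)
pose req n := odflt r0 (unpickle (logn 2 n)).
have next (s : {s | P s}) n : {x | P (x :: sval s) /\ Q (req n) (sval s) x}.
  by apply: cid; apply: PS; exact: (svalP s).
pose st := fix st n : {s | P s} :=
  if n is m.+1 then exist P _ (svalP (next (st m) m)).1 else exist P _ P0.
pose f n := sval (next (st n) n).
have stE n : sval (st n) = rev (mkseq f n).
  elim: n => [|n IH] //=; by rewrite -/(f n) IH mkseqS rev_rcons.
exists f; split=> [n|r m]; first by rewrite -stE; exact: (svalP (st n)).
exists (2 ^ pickle r * m.*2.+1); split.
  rewrite (leq_trans _ (leq_pmull _ _)) ?expn_gt0 //.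
  by rewrite -addnn -addSn leqW // leq_addr.
set n := (_ * _)%N.
have -> : r = req n.
  rewrite /req /n lognM ?expn_gt0 // pfactorK // logn_coprime ?addn0 ?pickleK //.
  by rewrite coprime2n /= odd_double.
by rewrite -stE /f; exact: (svalP (next (st n) n)).2.
Qed.

(* Satisfaction on a type whose points are meant up to [ieq]: an ultrapower
   before taking the quotient. *)
Record interpretation (I X : Type) := Interpretation {
  ieq : X -> X -> Prop;
  ile : X -> X -> Prop;
  icol : I -> X -> Prop;
  isat : forall n, formula I n -> n.-tuple X -> Prop;
  ieq_refl : forall x, ieq x x;
  ieq_sym : forall x y, ieq x y -> ieq y x;
  isat_congr : forall n (phi : formula I n) (v w : n.-tuple X),
    (forall i, ieq (tnth v i) (tnth w i)) -> isat phi v -> isat phi w;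
  isat_eq : forall n (i j : 'I_n) v,
    isat (Eq I i j) v <-> ieq (tnth v i) (tnth v j);
  isat_le : forall n (i j : 'I_n) v,
    isat (Le I i j) v <-> ile (tnth v i) (tnth v j);
  isat_col : forall n c (i : 'I_n) v, isat (Col c i) v <-> icol c (tnth v i);
  isat_bot : forall n (v : n.-tuple X), ~ isat (Bot I n) v;
  isat_imp : forall n (phi psi : formula I n) v,
    isat (Imp phi psi) v <-> (isat phi v -> isat psi v);
  isat_all : forall n (phi : formula I n.+1) v,
    isat (All phi) v <-> forall x, isat phi [tuple of x :: v]
}.

(** Ended by [Defined] so that its [isat] computes to [sat]. *)
Definition standard (I : Type) (M : structure I) : interpretation I M.
Proof.
by refine (@Interpretation I M eq le colour (@sat I M) _ _ _ _ _ _ _ _ _);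
  [ | move=> x y -> | move=> n phi v w /eq_from_tnth -> | | | | move=> n v [] | | ].
Defined.

Lemma ieq_trans (I X : Type) (J : interpretation I X) (x y z : X) :
  ieq J x y -> ieq J y z -> ieq J x z.
Proof.
move=> xy yz; pose F a := isat J (Eq I (@ord0 1) (lift ord0 ord0)) [tuple a; z].
have FE a : F a <-> ieq J a z by rewrite /F isat_eq tnthS !tnth0.
apply/FE; apply: (isat_congr (v := [tuple y; z])); last exact/FE.
move=> i; case: (unliftP ord0 i) => [j ->|->]; last by rewrite !tnth0; exact: ieq_sym.
by rewrite !tnthS; exact: ieq_refl.
Qed.

(* Downward Loewenheim-Skolem: the submodel contains the [e i], and [P] is an
   invariant of the finite stages of its construction. *)
Lemma elementary_submodel (I : countType) (X : Type) (J : interpretation I X)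
    (x0 : X) (R : countType) (e : R -> X) (P : seq X -> Prop) :
  P [::] ->
  (forall s i, P s -> P (e i :: s)) ->
  (forall s k (phi : formula I k.+1) (t : k.-tuple nat),
     P s -> (forall i, tnth t i < size s) ->
     exists x, P (x :: s) /\
       ((exists y, ~ isat J phi [tuple of y :: map (nth x0 (rev s)) t]) ->
        ~ isat J phi [tuple of x :: map (nth x0 (rev s)) t])) ->
  exists (f : nat -> X) (N : structure I) (g : N -> nat),
    [/\ countable [set: N]%classic,
        forall n, P (rev (mkseq f n)),
        forall n (phi : formula I n) (v : n.-tuple N),
          sat phi v <-> isat J phi [tuple f (g (tnth v i)) | i < n],
        forall m, exists x : N, ieq J (f (g x)) (f m)
      & forall i, exists x : N, ieq J (f (g x)) (e i)].
Proof.
move=> P0 Pe PS.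
(* A request either asks for [e i], or asks for a counterexample to [phi], if there is one, whose
   parameters are the terms of the sequence at the positions [t]. *)
pose req : countType := (R + {k : nat & formula I k.+1 * k.-tuple nat}%type)%type.
pose Q (r : req) s x := match r with
  | inl i => x = e i
  | inr (existT k (phi, t)) => (forall i, tnth t i < size s) ->
      (exists y, ~ isat J phi [tuple of y :: map (nth x0 (rev s)) t]) ->
        ~ isat J phi [tuple of x :: map (nth x0 (rev s)) t]
  end.
have r0 : req := inr (existT _ 0 (Bot I 1, [tuple])).
have [|f [Pf Qf]] := @generic_sequence X req r0 P Q P0.
  move=> s [i|[k [phi t]]] Ps; first by exists (e i); split; [exact: Pe|].
  have [ht|ht] := pselect (forall i, tnth t i < size s).
    by have [x [Px hx]] := PS s k phi t Ps ht; exists x; split=> // _.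
  have [|x [Px _]] := PS s 0 (Bot I 1) [tuple] Ps; first by case.
  by exists x; split.
(* Tarski-Vaught test for the range of [f]: the request for a counterexample is met at a stage
   beyond all the positions in [t], so a counterexample in [X] yields one of the form [f m]. *)
have tarski_vaught n (phi : formula I n.+1) (t : n.-tuple nat) :
    (forall m, isat J phi [tuple of f m :: map f t]) ->
    isat J (All phi) [tuple of map f t].
  move=> h; rewrite isat_all => y; apply: contrapT => hy.
  have [m [mt]] := Qf (inr (existT _ n (phi, t))) (\max_(i < n) tnth t i).+1.
  have lt i : tnth t i < m by apply: leq_trans mt; exact: leq_bigmax.
  rewrite /Q size_rev size_mkseq.
  have image x : [tuple of x :: map (nth x0 (rev (rev (mkseq f m)))) t] =
      [tuple of x :: map f t].
    apply: val_inj => /=; congr (_ :: _); apply/eq_in_map => k /tnthP[i ->].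
    by rewrite revK nth_mkseq.
  by move=> /(_ lt) Qm; apply: Qm; [exists y|]; rewrite image.
(* The quotient by [ieq] is a set of least representatives. *)
pose fresh m := `[< forall k, k < m -> ~ ieq J (f k) (f m) >].
have freshP m : exists x : {m | fresh m}, ieq J (f (val x)) (f m).
  have : exists k, `[< ieq J (f k) (f m) >] by exists m; apply/asboolP/ieq_refl.
  case/ex_minnP=> k /asboolP km kmin.
  suff kP : fresh k by exists (exist _ k kP).
  apply/asboolP => j jk jkE; suff: k <= j by rewrite leqNgt jk.
  by apply: kmin; apply/asboolP; exact: ieq_trans jkE km.
have fresh_inj (a b : {m | fresh m}) : ieq J (f (val a)) (f (val b)) -> a = b.
  have freshV (c : {m | fresh m}) k : k < val c -> ~ ieq J (f k) (f (val c)).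
    by move: (svalP c) => /asboolP; apply.
  move=> h; apply: val_inj; apply/eqP; rewrite eqn_leq; apply/andP.
  by split; rewrite leqNgt; apply/negP => /freshV; apply=> //; exact: ieq_sym.
pose N := @Structure I {m | fresh m} (fun a b => ile J (f (val a)) (f (val b)))
  (fun c a => icol J c (f (val a))).
exists f, N, val; split => //.
- exact: countableP.
- have image_cons n (v : n.-tuple N) (x : N) :
      [tuple f (val (tnth [tuple of x :: v] i)) | i < n.+1] =
      [tuple of f (val x) :: [tuple f (val (tnth v i)) | i < n]].
    apply: eq_from_tnth => i; rewrite tnth_mktuple.
    by case: (unliftP ord0 i) => [j ->|->]; rewrite ?tnthS ?tnth0 ?tnth_mktuple.
  move=> n phi; elim: phi => {n} [n i j|n i j|n c i|n|n p IHp q IHq|n p IHp] v.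
  + rewrite isat_eq !tnth_mktuple /=; split=> [->|h]; first exact: ieq_refl.
    exact: fresh_inj.
  + by rewrite isat_le !tnth_mktuple.
  + by rewrite isat_col !tnth_mktuple.
  + by split=> // /isat_bot.
  + by rewrite isat_imp -IHp -IHq.
  + split=> /= h; last first.
      by move=> x; rewrite IHp image_cons; move: h; rewrite isat_all.
    have /tarski_vaught : forall m,
        isat J p [tuple of f m :: map f [tuple val (tnth v i) | i < n]].
      move=> m; have [x xm] := freshP m.
      have := h x; rewrite IHp image_cons; apply: isat_congr => i.
      case: (unliftP ord0 i) => [j ->|->]; last by rewrite !tnth0.
      by rewrite !(tnthS, tnth_map, tnth_ord_tuple); exact: ieq_refl.
    apply: isat_congr => i; rewrite !(tnth_map, tnth_ord_tuple); exact: ieq_refl.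
- move=> i; have [m [_ mE]] := Qf (inl i) 0; have [x] := freshP m.
  by exists x; rewrite -mE.
Qed.

(* Los's theorem is the quantifier clause of this interpretation. *)
Lemma ultrapower (I K : Type) (U : set_system K) (M : structure I) :
  UltraFilter U ->
  exists J : interpretation I (K -> M),
    (forall n (phi : formula I n) v,
       isat J phi v <-> U (fun k => sat phi [tuple tnth v i k | i < n])) /\
    (forall x y, ieq J x y <-> U (fun k => x k = y k)).
Proof.
move=> UU.
have UT A : (forall k, A k) -> U A by move=> h; apply: filterS filterT.
have UI A B : U A -> U B -> U (fun k => A k /\ B k) by exact: filterI.
have US A B : U A -> (forall k, A k -> B k) -> U B by move=> UA AB; exact: filterS UA.
have UC A : ~ U A -> U (fun k => ~ A k) by case: (@in_ultra_setVsetC _ U A UU).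
have UE A B : (forall k, A k <-> B k) -> U A <-> U B.
  by move=> AB; split=> h; apply: US h _ => k /AB.
pose pt n (v : n.-tuple (K -> M)) k := [tuple tnth v i k | i < n].
have pt_cons n x (v : n.-tuple (K -> M)) k :
    pt _ [tuple of x :: v] k = [tuple of x k :: pt _ v k].
  apply: eq_from_tnth => i; rewrite tnth_mktuple.
  by case: (unliftP ord0 i) => [j ->|->]; rewrite ?tnthS ?tnth0 ?tnth_mktuple.
unshelve eexists (@Interpretation I (K -> M) (fun x y => U (fun k => x k = y k))
  (fun x y => U (fun k => le (x k) (y k))) (fun c x => U (fun k => colour c (x k)))
  (fun n phi v => U (fun k => sat phi (pt n v k))) _ _ _ _ _ _ _ _ _) => //=.
- by move=> x; apply: UT.
- by move=> x y h; apply: US h _.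
- move=> n phi v w vw h.
  have /(UI _ _ h) {}h : U (fun k => forall i, tnth v i k = tnth w i k).
    exact: filter_forall.
  apply: US h _ => k [h e]; congr (sat phi _): h.
  by apply: eq_from_tnth => i; rewrite !tnth_mktuple.
- by move=> n i j v; apply: UE => k; rewrite !tnth_mktuple.
- by move=> n i j v; apply: UE => k; rewrite !tnth_mktuple.
- by move=> n c i v; apply: UE => k; rewrite !tnth_mktuple.
- by move=> n v /filter_ex[].
- move=> n phi psi v; split=> [h1 h2|h]; first by apply: US (UI _ _ h1 h2) _ => k [f /f].
  have [h1|/UC h1] := pselect (U (fun k => sat phi (pt n v k))).
    by apply: US (h h1) _.
  by apply: US h1 _.
- move=> n phi v; split=> h.
    by move=> x; apply: US h _ => k /(_ (x k)); rewrite pt_cons.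
  apply: contrapT => /UC h1.
  (* [h1] provides a point of [M], the default value of [x] at the indices without a
     counterexample. *)
  have [k0 /existsNP[x0 _]] := filter_ex h1.
  have [|x hx] := @choice K M (fun k x => sat phi [tuple of x :: pt n v k] ->
      forall y, sat phi [tuple of y :: pt n v k]).
    move=> k; have [hk|/existsNP[x hx]] :=
      pselect (forall x, sat phi [tuple of x :: pt n v k]); first by exists x0.
    by exists x.
  have /filter_ex[k []] := UI _ _ h1 (h x).
  by rewrite pt_cons => hk /hx.
Qed.

(** * Equality of types and back-and-forth systems *)

Record eqtp I (M N : structure I) n (v : n.-tuple M) (w : n.-tuple N) : Prop :=
  Eqtp { eqtpE :> forall phi : formula I n, sat phi v <-> sat phi w }.

Record back_and_forth I (M N : structure I)
    (B : forall n, n.-tuple M -> n.-tuple N -> Prop) : Prop := BackAndForth {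
  baf_eq : forall n (v : n.-tuple M) (w : n.-tuple N), B n v w ->
    forall i j, tnth v i = tnth v j <-> tnth w i = tnth w j;
  baf_le : forall n (v : n.-tuple M) (w : n.-tuple N), B n v w ->
    forall i j, le (tnth v i) (tnth v j) <-> le (tnth w i) (tnth w j);
  baf_col : forall n (v : n.-tuple M) (w : n.-tuple N), B n v w ->
    forall c i, colour c (tnth v i) <-> colour c (tnth w i);
  baf_forth : forall n (v : n.-tuple M) (w : n.-tuple N), B n v w ->
    forall x, exists y, B n.+1 [tuple of x :: v] [tuple of y :: w];
  baf_back : forall n (v : n.-tuple M) (w : n.-tuple N), B n v w ->
    forall y, exists x, B n.+1 [tuple of x :: v] [tuple of y :: w]
}.

Lemma baf_eqtp I (M N : structure I)
    (B : forall n, n.-tuple M -> n.-tuple N -> Prop) n (v : n.-tuple M) (w : n.-tuple N) :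
  back_and_forth B -> B n v w -> eqtp v w.
Proof.
move=> [Beq Ble Bcol forth back] Bvw; split=> phi.
elim: phi v w Bvw => {n} [n i j|n i j|n c i|n|n p IHp q IHq|n p IHp] v w Bvw /=.
- exact: Beq.
- exact: Ble.
- exact: Bcol.
- by [].
- by rewrite (IHp v w) // (IHq v w).
- split=> h z.
    by have [x /IHp <-] := back _ _ _ Bvw z.
  by have [y /IHp ->] := forth _ _ _ Bvw z.
Qed.

Lemma isomorphic_eqtp I (M N : structure I) : isomorphic M N ->
  exists2 f : M -> N, bijective f &
    forall n (v : n.-tuple M), eqtp v [tuple f (tnth v i) | i < n].
Proof.
case=> f [fbij fle fcol]; exists f => // n v.
have f_cons k (u : k.-tuple M) x : [tuple f (tnth [tuple of x :: u] i) | i < k.+1] =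
    [tuple of f x :: [tuple f (tnth u i) | i < k]].
  apply: eq_from_tnth => i; rewrite tnth_mktuple.
  by case: (unliftP ord0 i) => [j ->|->]; rewrite ?tnthS ?tnth0 ?tnth_mktuple.
apply: (@baf_eqtp I M N (fun n v w => w = [tuple f (tnth v i) | i < n])) => //.
split=> {n v} n v w ->.
- by move=> i j; rewrite !tnth_mktuple; split=> [->//|]; apply: bij_inj.
- by move=> i j; rewrite !tnth_mktuple.
- by move=> c i; rewrite !tnth_mktuple.
- by move=> x; exists (f x).
- by case: fbij => g fK gK y; exists (g y); rewrite f_cons gK.
Qed.

Lemma tnth_rev (X : Type) (x0 : X) (s : seq X) k :
  k < size s -> exists i : 'I_(size s), tnth (in_tuple s) i = nth x0 (rev s) k.
Proof.
move=> ks; have lt : size s - k.+1 < size s by rewrite ltn_subrL (leq_ltn_trans _ ks).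
by exists (Ordinal lt); rewrite (tnth_nth x0) nth_rev.
Qed.

Lemma baf_isomorphic I (M N : structure I)
    (B : forall n, n.-tuple M -> n.-tuple N -> Prop) :
  countable [set: M]%classic -> countable [set: N]%classic ->
  back_and_forth B -> B 0 [tuple] [tuple] -> isomorphic M N.
Proof.
move=> /countable_injP[a a_inj] /countable_injP[b b_inj] BF B0.
have {}a_inj : injective a by move=> x y; apply: a_inj; rewrite in_setT.
have {}b_inj : injective b by move=> x y; apply: b_inj; rewrite in_setT.
have [Beq Ble Bcol forth back] := BF.
(* [m0] answers the requests [k] that are the code of no element. If [M] is empty, [back] shows that
   [N] is empty too. *)
have [[m0]|M0] := pselect (inhabited M); last first.
  have noM (x : M) : False by exact: M0.
  have noN (y : N) : False by have [x _] := back _ _ _ B0 y; exact: noM x.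
  exists (fun x => match noM x with end); split=> [|x|c x]; try by case: (noM x).
  by exists (fun y => match noN y with end) => x; [case: (noM x)|case: (noN x)].
pose B' (s : seq (M * N)) :=
  B (size s) (map_tuple fst (in_tuple s)) (map_tuple snd (in_tuple s)).
have B'S s x y : B (size s).+1 [tuple of x :: map_tuple fst (in_tuple s)]
    [tuple of y :: map_tuple snd (in_tuple s)] -> B' ((x, y) :: s).
  by congr (B _ _ _); apply: val_inj.
pose Q (r : nat + nat) (s : seq (M * N)) (x : M * N) :=
  match r with inl k => forall m, a m = k -> x.1 = m
             | inr k => forall m, b m = k -> x.2 = m end.
have [|s [k|k] Bs|f [Pf Qf]] := @generic_sequence _ (nat + nat)%type (inl 0) B' Q.
- by congr (B _ _ _): B0; apply: val_inj.
- have [[m mk]|h] := pselect (exists m, a m = k).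
    have [y /B'S] := forth _ _ _ Bs m; exists (m, y); split=> //= m'.
    by rewrite -mk => /a_inj.
  have [y /B'S] := forth _ _ _ Bs m0; exists (m0, y); split=> //= m'.
  by move=> mk; case: h; exists m'.
- have [[m mk]|h] := pselect (exists m, b m = k).
    have [x /B'S] := back _ _ _ Bs m; exists (x, m); split=> //= m'.
    by rewrite -mk => /b_inj.
  have [y /B'S] := forth _ _ _ Bs m0; exists (m0, y); split=> //= m'.
  by move=> mk; case: h; exists m'.
pose x0 := f 0.
(* Any two pairs of the sequence occur together in one stage, so [B] compares their coordinates. As
   all requests are met, the sequence lists the graph of an isomorphism. *)
have idx p q : exists n (v : n.-tuple M) (w : n.-tuple N) i j,
    [/\ B n v w, tnth v i = (f p).1, tnth v j = (f q).1,
       tnth w i = (f p).2 & tnth w j = (f q).2].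
  pose n := (maxn p q).+1; pose s := rev (mkseq f n).
  have get k : k < n -> exists i, tnth (in_tuple s) i = f k.
    move=> kn; have [|i e] := @tnth_rev _ x0 s k; first by rewrite size_rev size_mkseq.
    by exists i; rewrite e revK nth_mkseq.
  have [i ip] := get p (leq_maxl p q).
  have [j jq] := get q (leq_maxr p q).
  exists (size s), (map_tuple fst (in_tuple s)), (map_tuple snd (in_tuple s)), i, j.
  by rewrite !tnth_map ip jq; split=> //; exact: Pf.
have feq p q : (f p).1 = (f q).1 <-> (f p).2 = (f q).2.
  by have [n [v [w [i [j [/Beq h <- <- <- <-]]]]]] := idx p q.
have /choice[i fi] : forall x, exists n, (f n).1 = x.
  by move=> x; have [n [_ /(_ x erefl) h]] := Qf (inl (a x)) 0; exists n.
have /choice[j fj] : forall y, exists n, (f n).2 = y.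
  by move=> y; have [n [_ /(_ y erefl) h]] := Qf (inr (b y)) 0; exists n.
exists (fun x => (f (i x)).2); split.
- exists (fun y => (f (j y)).1) => x; first by rewrite -[RHS]fi feq fj.
  by rewrite -[RHS]fj -feq fi.
- move=> x y; have [n [v [w [p [q [/Ble h e1 e2 <- <-]]]]]] := idx (i x) (i y).
  by rewrite -h e1 e2 !fi.
- move=> c x; have [n [v [w [p [_ [/Bcol h e1 _ <- _]]]]]] := idx (i x) (i x).
  by rewrite -h e1 fi.
Qed.

(** * Ryll-Nardzewski *)

Section Types.
Variable I : countType.
Implicit Types M N : structure I.

Lemma eqtp_sym M N n (v : n.-tuple M) (w : n.-tuple N) : eqtp v w -> eqtp w v.
Proof. by move=> h; split=> phi; rewrite (h phi). Qed.

Lemma eqtp_trans M N (P : structure I) n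
    (v : n.-tuple M) (w : n.-tuple N) (u : n.-tuple P) :
  eqtp v w -> eqtp w u -> eqtp v u.
Proof. by move=> h1 h2; split=> phi; rewrite (h1 phi) (h2 phi). Qed.

Lemma eqtp_val M N n (v v' : n.-tuple M) (w w' : n.-tuple N) :
  val v = val v' -> val w = val w' -> eqtp v w -> eqtp v' w'.
Proof. by move=> /val_inj <- /val_inj <-. Qed.

Lemma eqtp_sub M N n (v : n.-tuple M) (w : n.-tuple N) k (s : 'I_k -> 'I_n) :
  eqtp v w -> eqtp [tuple tnth v (s i) | i < k] [tuple tnth w (s i) | i < k].
Proof. by move=> h; split=> phi; rewrite -!sat_rename (h _). Qed.

Lemma neqtp M n (v w : n.-tuple M) :
  ~ eqtp v w -> exists phi : formula I n, sat phi v /\ ~ sat phi w.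
Proof.
move=> vw; have /existsNP[phi h] : ~ forall phi : formula I n, sat phi v <-> sat phi w.
  by move=> h; apply: vw.
have [hv|hv] := pselect (sat phi v); have [hw|hw] := pselect (sat phi w).
- by case: h; split.
- by exists phi.
- by exists (Neg phi); split=> //; apply.
- by case: h; split.
Qed.

Definition isolated M n (v : n.-tuple M) :=
  exists2 theta : formula I n,
    sat theta v & forall w : n.-tuple M, sat theta w -> eqtp v w.

(** Colourings replace the space of types: a map to a finite set that refines equality of types,
    possibly with several colours for one type. *)
Definition finitely_many_types M :=
  forall n, exists k (c : n.-tuple M -> 'I_k),
    forall v w : n.-tuple M, c v = c w -> eqtp v w.

Lemma isolated_eqtp M n (v w : n.-tuple M) : eqtp v w -> isolated v -> isolated w.
Proof.
move=> h [theta hv htheta]; exists theta; first by rewrite -(h _).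
by move=> u /htheta vu; exact: eqtp_trans (eqtp_sym h) vu.
Qed.

(** If [theta] isolates the type of [v], the formula saying that some [w] satisfies [theta] and has
    the given variables as its subtuple along [s] isolates the type of the subtuple. *)
Lemma isolated_sub M n (v : n.-tuple M) k (s : 'I_k -> 'I_n) :
  isolated v -> isolated [tuple tnth v (s i) | i < k].
Proof.
case=> theta hv htheta.
pose phi : formula I (n + k) := Conj (rename theta (lshift k))
  (Bigconj (fun i : 'I_k => Eq I (lshift k (s i)) (rshift n i))).
have phiE (w : n.-tuple M) (u : k.-tuple M) : sat phi [tuple of w ++ u] <->
    sat theta w /\ u = [tuple tnth w (s i) | i < k].
  rewrite satC sat_bigconj sat_rename.
  have -> : [tuple tnth [tuple of w ++ u] (lshift k i) | i < n] = w.
    by apply: eq_from_tnth => i; rewrite tnth_mktuple tnth_lshift.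
  split=> -[h1 h2]; split=> //.
    apply: eq_from_tnth => i; rewrite tnth_mktuple.
    by have /= := h2 i; rewrite tnth_lshift tnth_rshift.
  by move=> i /=; rewrite tnth_lshift tnth_rshift h2 tnth_mktuple.
exists (Exs phi); first by apply/sat_exs; exists v; apply/phiE.
by move=> u /sat_exs[w /phiE[/htheta h ->]]; exact: eqtp_sub.
Qed.

Lemma countable_tuple M n : countable [set: M]%classic ->
  exists c : n.-tuple M -> nat, injective c.
Proof.
move=> /countable_injP[a a_inj].
exists (fun v => pickle [tuple a (tnth v i) | i < n]) => v w /(pcan_inj pickleK) e.
apply: eq_from_tnth => i; have := congr1 (fun t => tnth t i) e.
by rewrite !tnth_mktuple => /a_inj; apply; rewrite in_setT.
Qed.

Definition generalization n (phi : formula I n) : sentence I :=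
  Neg (Exs (rename (Neg phi) (lshift 0))).

Lemma sat_generalization M n (phi : formula I n) :
  theory M (generalization phi) <-> forall v : n.-tuple M, sat phi v.
Proof.
rewrite /theory /= -/(theory M) sat_exs.
have E (v : n.-tuple M) :
    sat (rename (Neg phi) (lshift 0)) [tuple of v ++ [tuple]] <->
    ~ sat phi v.
  rewrite sat_rename satN.
  suff -> : [tuple tnth [tuple of v ++ [tuple]] (lshift 0 i) | i < n] = v.
    by [].
  by apply: eq_from_tnth => i; rewrite tnth_mktuple tnth_lshift.
split=> [h v|h [v /E]]; last by apply.
by apply: contrapT => hv; apply: h; exists v; apply/E.
Qed.

Lemma eqtp_theory M N :
  models N (theory M) -> eqtp ([tuple] : 0.-tuple M) ([tuple] : 0.-tuple N).
Proof.
move=> NM; split=> phi; split=> [/NM//|h]; apply: contrapT => hM.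
exact: NM (Neg phi) hM h.
Qed.

(** Equality of types is a back-and-forth system between [M] and [N]: finitely many formulas isolate
    the [n]-types of [M] and cover its tuples, and both facts are expressed by sentences of its
    theory. *)
Lemma finitely_many_types_categorical M :
  countable [set: M]%classic -> finitely_many_types M -> aleph0_categorical M.
Proof.
move=> Mc fin; split=> // N Nc NM.
have gen n (phi : formula I n) (w : n.-tuple N) :
    (forall v : n.-tuple M, sat phi v) -> sat phi w.
  by move=> /sat_generalization /NM /sat_generalization.
have iso n : exists k (theta : 'I_k -> formula I n),
    (forall v : n.-tuple M, exists i, sat (theta i) v) /\
    (forall i (v w : n.-tuple M), sat (theta i) v -> sat (theta i) w -> eqtp v w).
  have [k [c hc]] := fin n; exists k.
  have /choice[theta ht] : forall i, exists theta : formula I n,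
      (forall v : n.-tuple M, c v = i -> sat theta v) /\
      (forall v w : n.-tuple M, sat theta v -> sat theta w -> eqtp v w).
    move=> i; have [[v vi]|h] := pselect (exists v, c v = i); last first.
      by exists (Bot I n); split=> // v vi; apply: h; exists v.
    (* [phi j] separates [v] from the tuples of colour [j], which share one type, unless that type
       is the type of [v]. The finite conjunction then isolates the type of [v]. *)
    have /choice[phi hphi] : forall j, exists phi : formula I n, sat phi v /\
        forall w, c w = j -> sat phi w -> eqtp v w.
      move=> j; have [[w [wj vw]]|h'] := pselect (exists w, c w = j /\ ~ eqtp v w).
        have [phi [hv hw]] := neqtp vw; exists phi; split=> // u uj hu.
        by case: hw; have /hc h' : c u = c w; rewrite ?uj // -(h' phi).
      exists (Tru I n); split=> // w wj _.
      by apply: contrapT => vw; apply: h'; exists w.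
    have hv (w : n.-tuple M) : sat (Bigconj phi) w -> eqtp v w.
      by move=> /sat_bigconj /(_ (c w)); apply: (hphi _).2.
    exists (Bigconj phi); split=> [w wi|w u /hv h1 /hv h2].
      have /hc h : c v = c w by rewrite wi.
      by rewrite -(h _); apply/sat_bigconj => j; exact: (hphi j).1.
    exact: eqtp_trans (eqtp_sym h1) h2.
  exists theta; split=> [v|i]; last exact: (ht i).2.
  by exists (c v); exact: (ht _).1.
have transfer n (theta : formula I n) (v : n.-tuple M) (w : n.-tuple N) :
    (forall v w : n.-tuple M, sat theta v -> sat theta w -> eqtp v w) ->
    sat theta v -> sat theta w -> eqtp v w.
  move=> ht hv hw.
  (* [theta] implies [chi] throughout [M] because its realisations there all have the type of [v];
     [gen] carries this implication over to [N]. *)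
  have half chi : sat chi v -> sat chi w.
    move=> hchi; have /= : sat (Imp theta chi) w; last by apply.
    by apply: gen => u /(ht v u hv) h; exact/(h chi).
  split=> chi; split; first exact: half.
  by move=> hchi; apply: contrapT => h; exact: half (Neg chi) h hchi.
apply: (@baf_isomorphic I M N (fun n v w => eqtp v w)) => //; last exact: eqtp_theory.
split=> n v w vw.
- by move=> i j; have := vw (Eq I i j).
- by move=> i j; have := vw (Le I i j).
- by move=> c i; have := vw (Col c i).
- move=> x; have [k [theta [tot ht]]] := iso n.+1.
  have [i hi] := tot [tuple of x :: v].
  have /(vw _)/satEx[y hy] : sat (Ex (theta i)) v by apply/satEx; exists x.
  by exists y; exact: transfer (ht i) hi hy.
- move=> y; have [k [theta [tot ht]]] := iso n.+1.
  have : sat (Neg (Bigconj (fun i => Neg (theta i)))) [tuple of y :: w].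
    by apply: gen => u /sat_bigconj h; have [i /(h i)] := tot u.
  move=> /satN; rewrite sat_bigconj => /existsNP[i /contrapT hi].
  have /(vw _)/satEx[x hx] : sat (Ex (theta i)) w by apply/satEx; exists y.
  by exists x; exact: transfer (ht i) hx hi.
Qed.

Section Categorical.
Variable T : structure I.
Hypothesis Tcat : aleph0_categorical T.

(* The diagonal of the sequence [t] realises all the [phi j] in an ultrapower,
   and a countable elementary submodel of it is a copy of T. *)
Lemma categorical_realizes n (phi : nat -> formula I n) :
  (forall k, exists v : n.-tuple T, forall j, j <= k -> sat (phi j) v) ->
  exists v : n.-tuple T, forall j, sat (phi j) v.
Proof.
case: n phi => [|n] phi h.
  by exists [tuple] => j; have [v /(_ j (leqnn j))] := h j; rewrite (tuple0 v).
have /choice[t ht] := h.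
have [U [UU sU]] := ultraFilterLemma eventually_filter.
have [J [Jsat Jeq]] := @ultrapower I nat U T UU.
pose e (i : 'I_n.+1) k := tnth (t k) i.
have [||f [N [g [Nc _ Nsat _ Ne]]]] :=
  @elementary_submodel I _ J (e ord0) 'I_n.+1 e (fun _ => True) Logic.I.
- by [].
- move=> s k psi u _ _; set F := map _ u.
  have [[y hy]|hn] := pselect (exists y, ~ isat J psi [tuple of y :: F]).
    by exists y.
  by exists (e ord0).
have NT : models N (theory T).
  move=> psi psiT; rewrite /theory /= Nsat Jsat; apply: filterS filterT => k _.
  by rewrite (tuple0 [tuple _ | _ < 0]); move: psiT; rewrite /theory /= (tuple0 [tuple]).
have [m [m' mK m'K] meq] := isomorphic_eqtp (Tcat.2 N Nc NT).
have /choice[c hc] := Ne.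
exists [tuple m' (c i) | i < n.+1] => j.
rewrite (meq _ _ (phi j)) Nsat.
apply: (isat_congr (v := [tuple e i | i < n.+1])).
  by move=> i; rewrite !tnth_mktuple m'K; exact: ieq_sym.
(* [t k] satisfies [phi j] as soon as [j <= k], and [U] contains the final segments of [nat]. *)
apply/Jsat; suff: U (fun k => j <= k).
  apply: filterS => k jk; congr (sat _ _): (ht k j jk).
  by apply: eq_from_tnth => i; rewrite !tnth_mktuple.
by apply: sU; exists j.
Qed.

(** Otherwise formulas compatible with [phi] can be strengthened forever, stage [k] excluding the
    tuple of code [k]; a tuple realising all of them is excluded at the stage of its own code. *)
Lemma isolated_dense n (phi : formula I n) (v : n.-tuple T) :
  sat phi v -> exists2 w : n.-tuple T, sat phi w & isolated w.
Proof.
move=> hv; apply: contrapT => hn.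
have [c c_inj] := countable_tuple n Tcat.1.
pose good (psi : formula I n) := exists2 w : n.-tuple T, sat phi w & sat psi w.
have next (psi : {psi | good psi}) k : {psi' : {psi | good psi} |
    forall w : n.-tuple T, sat (sval psi') w -> sat (sval psi) w /\ c w <> k}.
  apply: cid; case: psi => psi [w hw hpsi] /=.
  have [[u uk]|hk] := pselect (exists u, c u = k); last first.
    exists (exist _ psi (ex_intro2 _ _ w hw hpsi)) => u hu; split=> // uk.
    by apply: hk; exists u.
  have [w' [hw' hw'psi] ww'] :
      exists2 w' : n.-tuple T, sat phi w' /\ sat psi w' & ~ eqtp w w'.
    apply: contrapT => h; apply: hn; exists w => //.
    exists (Conj phi psi) => [|w' /satC h']; first by apply/satC.
    by apply: contrapT => ww'; apply: h; exists w'.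
  (* [w] and [w'] lie on opposite sides of [chi]: keep the side that does not contain [u]. *)
  have [chi [hchi hchi']] := neqtp ww'.
  have [hu|hu] := pselect (sat chi u).
    have h : good (Conj psi (Neg chi)) by exists w' => //; apply/satC.
    exists (exist _ _ h) => z /satC[hz1 hz2]; split=> // zk.
    by apply: hz2; have -> : z = u by apply: c_inj; rewrite uk.
  have h : good (Conj psi chi) by exists w => //; apply/satC.
  exists (exist _ _ h) => z /satC[hz1 hz2]; split=> // zk.
  by apply: hu; have <- : z = u by apply: c_inj; rewrite uk.
have good0 : good (Tru I n) by exists v.
pose st := fix st k := if k is j.+1 then sval (next (st j) j) else exist _ _ good0.
have stS k w : sat (sval (st k.+1)) w -> sat (sval (st k)) w /\ c w <> k.
  exact: svalP (next (st k) k) w.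
have [k|w hw] := @categorical_realizes n (fun k => sval (st k)).
  have [w _ hw] := svalP (st k); exists w => j /subnK e.
  move: hw; rewrite -e; elim: (k - j) => [//|m IH] /stS[+ _]; exact: IH.
by have [_] := stS _ _ (hw (c w).+1).
Qed.

(** Density gives an isolated tuple [w] whose tail has the type of [v]; the formula isolating [w]
    then lets its head be copied over [v]. *)
Lemma isolated_extend n (v : n.-tuple T) (phi : formula I n.+1) x :
  isolated v -> sat phi [tuple of x :: v] ->
  exists2 y, sat phi [tuple of y :: v] & isolated [tuple of y :: v].
Proof.
move=> [theta hv htheta] hx.
have tail (w : n.-tuple T) y : [tuple tnth [tuple of y :: w] (lift ord0 i) | i < n] = w.
  by apply: eq_from_tnth => i; rewrite tnth_mktuple tnthS.
have [|w /satC[w1 w2] [eta hw heta]] :=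
    @isolated_dense _ (Conj phi (rename theta (lift ord0))) [tuple of x :: v].
  by apply/satC; rewrite sat_rename tail.
move: w1 w2 hw heta; rewrite (tuple_eta w) sat_rename tail => w1 w2 hw heta.
have /(htheta _ w2 _)/satEx[y /satC[y1 y2]] :
    sat (Ex (Conj phi eta)) [tuple of behead w].
  by apply/satEx; exists (thead w); apply/satC.
by exists y => //; apply: isolated_eqtp (heta _ y2) _; exists eta.
Qed.

(* An atomic elementary submodel is built inside [T], which is a copy of it. *)
Lemma categorical_isolated n (v : n.-tuple T) : isolated v.
Proof.
have [[x0]|T0] := pselect (inhabited T); last first.
  case: n v => [|n] v; last by case: T0; exact: inhabits (thead v).
  by exists (Tru I 0) => // w _; rewrite (tuple0 w) (tuple0 v).
pose e (i : void) : T := match i with end.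
have [||s k phi t Ps ts|f [N [g [Nc Pf Nsat _ _]]]] :=
  @elementary_submodel I _ (standard T) x0 void e (fun s => isolated (in_tuple s)).
- have all_eq (u w : 0.-tuple T) : u = w by rewrite (tuple0 u) (tuple0 w).
  by exists (Tru I 0) => // w _; rewrite (all_eq w (in_tuple [::])).
- by move=> s [].
- have /choice[sig hsig] : forall i, exists j : 'I_(size s),
      tnth (in_tuple s) j = nth x0 (rev s) (tnth t i).
    by move=> i; exact: tnth_rev.
  pose psi := rename (Neg phi) (lift_var sig).
  have psiE y : sat psi [tuple of y :: in_tuple s] <->
      ~ sat phi [tuple of y :: map (nth x0 (rev s)) t].
    rewrite sat_rename satN.
    suff -> : [tuple tnth [tuple of y :: in_tuple s] (lift_var sig i) | i < k.+1] =
        [tuple of y :: map (nth x0 (rev s)) t] by [].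
    apply: eq_from_tnth => i; rewrite tnth_mktuple /lift_var.
    case: (unliftP ord0 i) => [j ->|->] /=; last by rewrite !tnth0.
    by rewrite !tnthS tnth_map hsig.
  have consE y : isolated [tuple of y :: in_tuple s] -> isolated (in_tuple (y :: s)).
    by congr isolated; apply: val_inj.
  have [[y hy]|hn] :=
    pselect (exists y, ~ sat phi [tuple of y :: map (nth x0 (rev s)) t]).
    have /(isolated_extend Ps)[z /psiE hz /consE Pz] : sat psi [tuple of y :: in_tuple s].
      exact/psiE.
    by exists z.
  have [//|z _ /consE Pz] := @isolated_extend _ _ (Tru I _) x0 Ps.
  by exists z.
have NT : models N (theory T).
  move=> psi; rewrite /theory /= (Nsat _ _ _) /=.
  by rewrite (tuple0 [tuple _ | _ < 0]) (tuple0 [tuple]).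
have [m _ meq] := isomorphic_eqtp (Tcat.2 N Nc NT).
(* [g] and [f] bring the copy of [v] in [N] back into [T] as a tuple of the same type, all of whose
   coordinates occur in the isolated finite stage [s]. *)
apply: (@isolated_eqtp _ _ [tuple f (g (m (tnth v i))) | i < n]).
  apply: eqtp_sym; split=> phi; rewrite (meq _ _ phi) Nsat /=.
  suff -> : [tuple f (g (tnth [tuple m (tnth v i0) | i0 < n] i)) | i < n] = 
      [tuple f (g (m (tnth v i))) | i < n] by [].
  by apply: eq_from_tnth => i; rewrite !tnth_mktuple.
pose b := (\max_(i < n) g (m (tnth v i))).+1; pose s := rev (mkseq f b).
have /choice[sig hsig] : forall i, exists j : 'I_(size s),
    tnth (in_tuple s) j = f (g (m (tnth v i))).
  move=> i; have lt : g (m (tnth v i)) < b.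
    by rewrite ltnS; exact: (@leq_bigmax _ (fun j : 'I_n => g (m (tnth v j)))).
  have [|j jE] := @tnth_rev _ x0 s (g (m (tnth v i))); first by rewrite size_rev size_mkseq.
  by exists j; rewrite jE revK nth_mkseq.
have := @isolated_sub _ _ _ _ sig (Pf b).
by congr isolated; apply: eq_from_tnth => i; rewrite !tnth_mktuple -hsig.
Qed.

(** Let [phi k] deny the type of the tuple of code [k]. No tuple satisfies all of them, so some
    finite batch is never satisfied at once, and the index of a formula that fails is a colour. *)
Lemma categorical_finitely_many_types : finitely_many_types T.
Proof.
move=> n; have [c c_inj] := countable_tuple n Tcat.1.
have /choice[phi hphi] : forall k, exists phi : formula I n,
    (forall v, c v = k -> ~ sat phi v) /\
    (forall v w : n.-tuple T, ~ sat phi v -> ~ sat phi w -> eqtp v w).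
  move=> k; have [[u uk]|h] := pselect (exists u, c u = k); last first.
    exists (Tru I n); split=> [v vk|v w h1 _]; first by case: h; exists v.
    by case: h1; exact: satT.
  have [theta hu htheta] := categorical_isolated u.
  exists (Neg theta); split=> [v vk|v w /contrapT h1 /contrapT h2].
    by have -> : v = u; [apply: c_inj; rewrite uk|move/satN].
  exact: eqtp_trans (eqtp_sym (htheta _ h1)) (htheta _ h2).
have [h|/existsNP[k hk]] := pselect
  (forall k, exists v : n.-tuple T, forall j, j <= k -> sat (phi j) v).
  have [v hv] := categorical_realizes h.
  by case: ((hphi (c v)).1 v erefl (hv _)).
have /choice[d hd] : forall v : n.-tuple T, exists j : 'I_k.+1, ~ sat (phi j) v.
  move=> v; apply: contrapT => h; apply: hk; exists v => j jk.
  by apply: contrapT => hj; apply: h; exists (Ordinal (jk : j < k.+1)).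
exists k.+1, d => v w e; apply: (hphi (d v)).2; first exact: hd.
by rewrite e; exact: hd.
Qed.

End Categorical.
End Types.

(** * Maximal chains *)

Section PairTypes.
Variables (I : countType) (M : structure I).

Lemma eqtp2 (x y x' y' : M) : eqtp [tuple x; y] [tuple x'; y'] ->
  eqtp [tuple x] [tuple x'] /\ eqtp [tuple y] [tuple y'].
Proof.
move=> h; pose s (j : 'I_2) (i : 'I_1) := j.
split; [have := eqtp_sub (s ord0) h|have := eqtp_sub (s ord_max) h];
  by congr eqtp; apply: eq_from_tnth => -[[|i] lti]; rewrite // tnth_mktuple !(tnth_nth x).
Qed.

Lemma eqtp_diag (x x' : M) : eqtp [tuple x] [tuple x'] -> eqtp [tuple x; x] [tuple x'; x'].
Proof.
move=> h; have := eqtp_sub (fun i : 'I_2 => ord0) h.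
by congr eqtp; apply: eq_from_tnth => -[[|[|i]] lti];
  rewrite // tnth_mktuple !(tnth_nth x).
Qed.

Lemma eqtp3 (x y z x' y' z' : M) : eqtp [tuple x; y; z] [tuple x'; y'; z'] ->
  eqtp [tuple y; x] [tuple y'; x'] /\ eqtp [tuple x; z] [tuple x'; z'].
Proof.
move=> h; pose s (a b : 'I_3) (i : 'I_2) := if i == ord0 then a else b.
split; [have := eqtp_sub (s (lift ord0 ord0) ord0) h|have := eqtp_sub (s ord0 ord_max) h];
  by congr eqtp; apply: eq_from_tnth => -[[|[|i]] lti];
  rewrite // tnth_mktuple !(tnth_nth x).
Qed.

Lemma eqtp_le (x y x' y' : M) : eqtp [tuple x; y] [tuple x'; y'] -> le x y -> le x' y'.
Proof.
by move=> /(_ (Le I ord0 ord_max)) /=; rewrite !(tnth_nth x) /= => h /h.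
Qed.

Lemma eqtp_eq (x y x' y' : M) : eqtp [tuple x; y] [tuple x'; y'] -> x = y -> x' = y'.
Proof.
by move=> /(_ (Eq I ord0 ord_max)) /=; rewrite !(tnth_nth x) /= => h /h.
Qed.

Lemma eqtp_colour (x x' : M) c : eqtp [tuple x] [tuple x'] -> colour c x <-> colour c x'.
Proof. by move=> /(_ (Col c ord0)) /=; rewrite !(tnth_nth x). Qed.

(** Homogeneity of atomic structures: [w] satisfies the formula obtained by quantifying [x]
    existentially in the one isolating [x :: v]. *)
Lemma isolated_homogeneous n (v w : n.-tuple M) (x : M) :
  isolated [tuple of x :: v] -> eqtp v w ->
  exists y, eqtp [tuple of x :: v] [tuple of y :: w].
Proof.
move=> [theta hx htheta] vw.
have /(vw _)/satEx[y hy] : sat (Ex theta) v by apply/satEx; exists x.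
by exists y; exact: htheta.
Qed.

End PairTypes.

(** [R] is only a total preorder: it will compare positions of a tuple, whose entries may
    coincide. *)
Lemma finite_max (K : finType) (P : K -> Prop) (R : K -> K -> Prop) a0 :
  (forall a b, R a b \/ R b a) -> (forall a b c, R a b -> R b c -> R a c) ->
  P a0 -> exists2 a, P a & forall b, P b -> R b a.
Proof.
move=> tot tr Pa0.
suff [a Pa ha] : exists2 a, P a & forall b, b \in enum K -> P b -> R b a.
  by exists a => // b; apply: ha; rewrite mem_enum.
elim: (enum K) => [|b s [a Pa ha]]; first by exists a0.
have [[Pb ab]|h] := pselect (P b /\ R a b).
  exists b => // c; rewrite inE => /predU1P[-> _|cs /(ha _ cs) ca]; last exact: tr ca ab.
  by case: (tot b b).
exists a => // c; rewrite inE => /predU1P[->|/ha//] Pb.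
by case: (tot b a) => // ab; case: h.
Qed.

Lemma ultra_finite (X : Type) (U : set_system X) k (c : X -> 'I_k) :
  UltraFilter U -> exists i, U (fun x => c x = i).
Proof.
move=> UU; apply: contrapT => h.
have : U (fun x => forall i, c x <> i).
  apply: filter_forall => i.
  by case: (@in_ultra_setVsetC _ U (fun x => c x = i) UU) => // ci; case: h; exists i.
by case/filter_ex => x /(_ (c x)).
Qed.

(** * Back and forth inside a downward closed chain *)

Section Chain.
Variables (I : countType) (T : structure I) (L : set T).
Hypothesis T_order : Relation_Definitions.order T le.
Hypothesis L_total : total_on L le.
Hypothesis L_down : forall x y, L x -> le y x -> L y.
Hypothesis T_isolated : forall n (v : n.-tuple T), isolated v.

Let le_refl x : @le _ T x x. Proof. by case: T_order => r _ _; exact: r. Qed.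
Let le_trans y x z : @le _ T x y -> le y z -> le x z.
Proof. by case: T_order => _ t _; exact: t. Qed.
Let le_anti x y : @le _ T x y -> le y x -> x = y.
Proof. by case: T_order => _ _ a; exact: a. Qed.

Variable A : set T.
Hypothesis AL : forall u, A u -> L u.
Hypothesis A_cofinal : forall t, L t -> exists2 u, A u & le t u.
(** Cuts the unbounded interval above [u] at a point [u'] beyond [t], with a matching cut [v'] above
    [v]. *)
Hypothesis A_indisc : forall u v t, A u -> A v -> L t -> le u t ->
  exists u' v', [/\ A u', A v', le t u' & eqtp [tuple u; u'] [tuple v; v']].

(* [inl false] and [inl true] are formal end points -oo and +oo of [L]. *)
Definition point := (bool + T)%type.

Definition lep (p q : point) : Prop :=
  match p, q with
  | inl b, inl b' => b <= b'
  | inl b, inr _ => ~~ b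
  | inr _, inl b => b
  | inr x, inr y => le x y
  end.

Definition in_chain (p : point) : Prop := if p is inr x then L x else True.

Definition same_type (p p' : point) : Prop :=
  match p, p' with
  | inl b, inl b' => b = b'
  | inr x, inr x' => eqtp [tuple x] [tuple x']
  | _, _ => False
  end.

(* A similarity extends to a back-and-forth system between the intervals [p, q]
   and [p', q'] of the chain; [similar_cat] is needed because the type of (p, r)
   in the tree is not determined by those of (p, q) and (q, r). *)
Inductive similar : point -> point -> point -> point -> Prop :=
| similar_end b : similar (inl b) (inl b) (inl b) (inl b)
| similar_below x y : L x -> L y -> eqtp [tuple x] [tuple y] ->
    similar (inl false) (inr x) (inl false) (inr y)
| similar_mid x z y w : L z -> L w -> le x z -> eqtp [tuple x; z] [tuple y; w] ->
    similar (inr x) (inr z) (inr y) (inr w)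
| similar_above u v : A u -> A v ->
    similar (inr u) (inl true) (inr v) (inl true)
| similar_cat p q r p' q' r' : similar p q p' q' -> similar q r q' r' ->
    similar p r p' r'.

Lemma lep_refl p : lep p p.
Proof. by case: p => [[]|x] //; exact: le_refl. Qed.

Lemma lep_trans q p r : lep p q -> lep q r -> lep p r.
Proof.
by case: p q r => [[]|x] [[]|y] [[]|z] //=; exact: le_trans.
Qed.

Lemma lep_anti p q : lep p q -> lep q p -> p = q.
Proof. by case: p q => [[]|x] [[]|y] //= h1 h2; rewrite (le_anti h1 h2). Qed.

Lemma lep_total p q : in_chain p -> in_chain q -> lep p q \/ lep q p.
Proof.
case: p q => [[]|x] [[]|y] //=; try by [left|right].
by move=> Lx Ly; exact: L_total.
Qed.

Lemma similar_in p q p' q' : similar p q p' q' ->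
  in_chain p /\ in_chain q.
Proof.
elim=> {p q p' q'} //= [x z y w Lz _ xz _|u v /AL //|p q r p' q' r' _ [h _] _ [_ h'] //].
by split=> //; exact: L_down xz.
Qed.

Lemma similar_sym p q p' q' : similar p q p' q' -> similar p' q' p q.
Proof.
elim=> {p q p' q'}.
- by move=> b; exact: similar_end.
- by move=> x y Lx Ly xy; apply: similar_below => //; exact: eqtp_sym.
- move=> x z y w Lz Lw xz h; apply: similar_mid => //; last exact: eqtp_sym.
  exact: eqtp_le xz.
- by move=> u v Au Av; exact: similar_above.
- by move=> p q r p' q' r' _ h1 _ h2; exact: similar_cat h1 h2.
Qed.

Lemma similar_lep p q p' q' : similar p q p' q' -> lep p q.
Proof.
elim=> {p q p' q'} //= p q r p' q' r' _ h1 _ h2; exact: lep_trans h1 h2.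
Qed.

Lemma similar_same_type p q p' q' : similar p q p' q' ->
  same_type p p' /\ same_type q q'.
Proof.
elim=> {p q p' q'} //=
  [x z y w _ _ _ /eqtp2 //|u v Au Av|p q r p' q' r' _ [h _] _ [_ h'] //].
(* All members of [A] have one type, since the equal pair types given by [A_indisc] restrict to
   their first members. *)
have [u' [v' [_ _ _ /eqtp2[]]]] := A_indisc Au Av (AL Au) (le_refl u).
by split.
Qed.

Lemma similar_eq p q p' q' : similar p q p' q' -> p = q -> p' = q'.
Proof.
elim=> {p q p' q'} // [x z y w _ _ _ h [xz]|p q r p' q' r' h1 IH1 h2 IH2 pr].
  by congr inr; exact: eqtp_eq h xz.
have pq : p = q.
  by apply: lep_anti; [exact: similar_lep h1|rewrite pr; exact: similar_lep h2].
by rewrite IH1 // IH2 // -pq.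
Qed.

(** Homogeneity of [T] supplies [s], and downward closure puts it in [L] because it lies below
    [w]. *)
Lemma similar_mid_split x z y w t : L z -> L w -> le x t -> le t z ->
  eqtp [tuple x; z] [tuple y; w] ->
  exists2 s, L s & similar (inr x) (inr t) (inr y) (inr s) /\
    similar (inr t) (inr z) (inr s) (inr w).
Proof.
move=> Lz Lw xt tz h.
have [s hs] := isolated_homogeneous (T_isolated [tuple of t :: [tuple x; z]]) h.
have /eqtp3[h1 _] : eqtp [tuple t; x; z] [tuple s; y; w].
  exact: eqtp_val hs.
have /eqtp3[_ h2] : eqtp [tuple t; x; z] [tuple s; y; w].
  exact: eqtp_val hs.
have sw : le s w by exact: eqtp_le tz.
have Ls := L_down Lw sw; have Lt := L_down Lz tz.
by exists s => //; split; apply: similar_mid.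
Qed.

(** The forth step in one interval, by induction on the similarity. A point below [x] is copied by
    homogeneity, one in [[u, +oo)] after cutting at a member of [A] above it, and a concatenation is
    split in the part that contains the point. *)
Lemma similar_split p q p' q' t : similar p q p' q' -> L t ->
  lep p (inr t) -> lep (inr t) q ->
  exists2 s, L s & similar p (inr t) p' (inr s) /\ similar (inr t) q (inr s) q'.
Proof.
move=> + Lt; elim=> {p q p' q'}.
- by case.
- move=> x y Lx Ly xy _ /= tx.
  have [s hs] := isolated_homogeneous (T_isolated [tuple of t :: [tuple x]]) xy.
  have {}hs : eqtp [tuple t; x] [tuple s; y].
    exact: eqtp_val hs.
  have Ls := L_down Ly (eqtp_le hs tx).
  exists s => //; split; last exact: similar_mid.
  by apply: similar_below => //; exact: (eqtp2 hs).1.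
- move=> x z y w Lz Lw _ h /= xt tz; exact: similar_mid_split h.
- move=> u v Au Av /= ut _.
  have [u' [v' [Au' Av' tu' h]]] := A_indisc Au Av Lt ut.
  have [s Ls [h1 h2]] := similar_mid_split (AL Au') (AL Av') ut tu' h.
  by exists s => //; split=> //; apply: similar_cat h2 _; exact: similar_above.
- move=> p q r p' q' r' h1 IH1 h2 IH2 pt tr.
  have [tq|qt] : lep (inr t) q \/ lep q (inr t).
    by apply: lep_total => //; exact: (similar_in h1).2.
  + have [s Ls [g1 g2]] := IH1 pt tq.
    by exists s => //; split=> //; exact: similar_cat g2 h2.
  + have [s Ls [g1 g2]] := IH2 qt tr.
    by exists s => //; split=> //; exact: similar_cat h1 g1.
Qed.

Definition entry n (v : n.-tuple (induced L)) (a : bool + 'I_n) : point :=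
  match a with inl b => inl b | inr i => inr (val (tnth v i)) end.

(** All ordered pairs of entries are compared, formal end points included, so the coordinates may
    come in any order and repeat. *)
Definition similar_tuples n (v w : n.-tuple (induced L)) :=
  forall a b, lep (entry v a) (entry v b) ->
    similar (entry v a) (entry v b) (entry w a) (entry w b).

Lemma entry_in n (v : n.-tuple (induced L)) a : in_chain (entry v a).
Proof. by case: a => [//|i] /=; exact: set_valP. Qed.

(** The delicate pairs are those ordered one way in [w] and the other way in [v]: the two entries of
    [w] then coincide by antisymmetry, hence those of [v] by [similar_eq]. *)
Lemma similar_tuples_sym n (v w : n.-tuple (induced L)) :
  similar_tuples v w -> similar_tuples w v.
Proof.
move=> vw a b wab.
have [vab|vba] := lep_total (entry_in v a) (entry_in v b).
  exact/similar_sym/vw.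
have sba := vw _ _ vba.
have eab : entry w a = entry w b.
  exact: lep_anti wab (similar_lep (similar_sym sba)).
have vE := similar_eq (similar_sym sba) (esym eab).
by rewrite eab -vE; apply: similar_sym; exact: vw (lep_refl _).
Qed.

(** [x] lies between nearest entries [a] and [b], which exist thanks to the formal end points.
    Splitting [[a, b]] at [x] gives [s], and concatenation through [a] or [b] handles every other
    entry. *)
Lemma similar_tuples_extend n (v w : n.-tuple (induced L)) (x : induced L) :
  similar_tuples v w ->
  exists y, similar_tuples [tuple of x :: v] [tuple of y :: w].
Proof.
move=> vw; have Lx : L (val x) by exact: set_valP.
pose le_entry (c d : bool + 'I_n) := lep (entry v c) (entry v d).
have le_total c d : le_entry c d \/ le_entry d c.
  by apply: lep_total; exact: entry_in.
have [a ax amax] := @finite_max _ (fun c => lep (entry v c) (inr (val x))) le_entry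
  (inl false) le_total (fun _ _ _ => @lep_trans _ _ _) isT.
have [b xb bmin] := @finite_max _ (fun c => lep (inr (val x)) (entry v c))
  (fun c d => le_entry d c) (inl true) (fun c d => le_total d c)
  (fun _ _ _ h1 h2 => lep_trans h2 h1) isT.
have [s Ls [sa sb]] := similar_split (vw a b (lep_trans ax xb)) Lx ax xb.
have s_in : s \in L by rewrite in_setE.
exists (exist _ s s_in : induced L) => c d.
set y : induced L := exist _ s s_in.
have entryE (e : bool + 'I_n.+1) :
    entry [tuple of x :: v] e = inr (val x) /\ entry [tuple of y :: w] e = inr s \/
    exists e', entry [tuple of x :: v] e = entry v e' /\
      entry [tuple of y :: w] e = entry w e'.
  case: e => [e|i]; first by right; exists (inl e).
  case: (unliftP ord0 i) => [j ->|->] /=; last by left; rewrite !tnth0.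
  by right; exists (inr j); rewrite !tnthS.
case: (entryE c) => [[-> ->]|[c' [-> ->]]]; case: (entryE d) => [[-> ->]|[d' [-> ->]]].
- move=> _; apply: similar_mid => //; apply: eqtp_diag.
  exact: (similar_same_type sa).2.
- by move=> /bmin bd; exact: similar_cat sb (vw _ _ bd).
- by move=> /amax ca; exact: similar_cat (vw _ _ ca) sa.
- exact: vw.
Qed.

Lemma similar_tuples_eqtp n (v w : n.-tuple (induced L)) :
  similar_tuples v w -> eqtp v w.
Proof.
apply: (baf_eqtp (B := similar_tuples)); split=> {n v w} n v w vw.
- have half (v' w' : n.-tuple (induced L)) i j : similar_tuples v' w' ->
      tnth v' i = tnth v' j -> tnth w' i = tnth w' j.
    move=> h e; have /(h (inr i) (inr j)) /similar_eq :
        lep (entry v' (inr i)) (entry v' (inr j)).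
      by rewrite /= e; exact: le_refl.
    by rewrite /= e => /(_ erefl) [/val_inj].
  by move=> i j; split; apply: half => //; exact: similar_tuples_sym.
- have half (v' w' : n.-tuple (induced L)) i j : similar_tuples v' w' ->
      le (tnth v' i) (tnth v' j) -> le (tnth w' i) (tnth w' j).
    by move=> h /(h (inr i) (inr j)) /similar_sym /similar_lep.
  by move=> i j; split; apply: half => //; exact: similar_tuples_sym.
- move=> c i; have /similar_same_type[/= h _] := vw (inr i) (inr i) (lep_refl _).
  exact: eqtp_colour h.
- move=> x; exact: similar_tuples_extend.
- move=> y; have [x h] := similar_tuples_extend y (similar_tuples_sym vw).
  by exists x; exact: similar_tuples_sym.
Qed.

(** A tuple is coloured by the values of [c] on the pairs of its coordinates and on each coordinate
    [x] paired with [top x], a member of [A] above it; the latter controls [[x, +oo)]. *)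
Lemma chain_finitely_many_types k (c : 2.-tuple T -> 'I_k) :
  (forall v w, c v = c w -> eqtp v w) -> (exists u, A u) ->
  finitely_many_types (induced L).
Proof.
move=> hc [u0 Au0] n.
have /choice[top htop] : forall x, exists u, L x -> A u /\ le x u.
  move=> x; have [Lx|Lx] := pselect (L x); last by exists x.
  by have [u Au xu] := A_cofinal Lx; exists u.
pose K : finType := ({ffun 'I_n * 'I_n -> 'I_k} * {ffun 'I_n -> 'I_k})%type.
pose d (v : n.-tuple (induced L)) : K :=
  ([ffun ij => c [tuple val (tnth v ij.1); val (tnth v ij.2)]],
   [ffun i => c [tuple val (tnth v i); top (val (tnth v i))]]).
exists #|K|, (fun v => enum_rank (d v)) => v w /enum_rank_inj[/ffunP h1 /ffunP h2].
have {}h1 i j : eqtp [tuple val (tnth v i); val (tnth v j)]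
    [tuple val (tnth w i); val (tnth w j)].
  by apply: hc; have := h1 (i, j); rewrite !ffunE.
have {}h2 i : eqtp [tuple val (tnth v i); top (val (tnth v i))]
    [tuple val (tnth w i); top (val (tnth w i))].
  by apply: hc; have := h2 i; rewrite !ffunE.
have Lv (u : n.-tuple (induced L)) i : L (val (tnth u i)) by exact: set_valP.
apply: similar_tuples_eqtp => -[[]|i] [[]|j] //= => [_|_|_|_|_|ij].
- exact: similar_end.
- apply: (@similar_cat _ (inr u0) _ _ (inr u0)); last exact: similar_above.
  by apply: similar_below => //; exact: AL.
- exact: similar_end.
- by apply: similar_below; [exact: Lv|exact: Lv|exact: (eqtp2 (h1 j j)).1].
- have [Av lev] := htop _ (Lv v i); have [Aw _] := htop _ (Lv w i).
  apply: similar_cat (similar_above Av Aw).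
  by apply: similar_mid; [exact: AL|exact: AL|exact: lev|exact: h2].
- by apply: similar_mid; [exact: Lv|exact: Lv|exact: ij|exact: h1].
Qed.

End Chain.

Theorem theorem2p10 (I : countType) (T : structure I)
    (T_tree : coloured_tree T) (T_countable : countable [set: T]%classic)
    (T_categorical : aleph0_categorical T)
    (L : set T) (L_max : maximal_chain le L) :
  coloured_linear_order (induced L) /\ aleph0_categorical (induced L).
Proof.
have [[T_order tree_below _] T_colours] := T_tree.
have [le_refl le_trans le_anti] := T_order.
have [L_total L_maximal] := L_max.
have Lval (x : induced L) : L (val x) by exact: set_valP.
split.
  split=> [|x y _ _|i j x]; first 1 last.
  - exact: L_total.
  - exact: T_colours.
  - split=> [x|x y z|x y xy yx]; [exact: le_refl|exact: le_trans|].
    by apply: val_inj; exact: le_anti.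
have L_down x y : L x -> le y x -> L y.
  (* Adding [y] to [L] keeps it a chain: any [z] of [L] is above [x], hence above [y], or below [x]
     and then comparable with [y] by the tree axiom. *)
  move=> Lx yx; suff <- : (fun z => L z \/ z = y) = L by right.
  have comparable z : L z -> le y z \/ le z y.
    move=> Lz; have [xz|zx] := L_total x z Lx Lz; first by left; exact: le_trans xz.
    by have [] := tree_below y z x yx zx; [left|right].
  apply: L_maximal => [a b [La|->] [Lb|->]|z Lz]; last by left.
  - exact: L_total.
  - by case: (comparable a La); [right|left].
  - exact: comparable.
  - by left.
apply: finitely_many_types_categorical.
  have /countable_injP[a a_inj] := T_countable.
  apply/countable_injP; exists (fun x => a (val x)) => x y _ _ e.
  by apply: val_inj; apply: a_inj; rewrite ?in_setT.
have [[x0 Lx0]|L0] := pselect (exists x, L x); last first.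
  case=> [|n]; exists 1, (fun _ => ord0) => v w _.
    by rewrite (tuple0 v) (tuple0 w).
  by case: L0; exists (val (thead v)); exact: set_valP.
have [k [c hc]] := categorical_finitely_many_types T_categorical 2.
(* The filter of the sets containing a final segment of [L]. *)
pose final (S : set T) := exists2 x, L x & forall y, L y -> le x y -> S y.
have final_proper : ProperFilter final.
  apply: Build_ProperFilter_ex.
    by move=> S [x Lx Sx]; exists x; apply: Sx => //; exact: le_refl.
  split.
  - by exists x0.
  - move=> S S' [x Lx Sx] [x' Lx' Sx'].
    have [xx'|x'x] := L_total x x' Lx Lx'.
      by exists x' => // y Ly x'y; split; [apply: Sx|apply: Sx'] => //; exact: le_trans x'y.
    by exists x => // y Ly xy; split; [apply: Sx|apply: Sx'] => //; exact: le_trans xy.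
  - by move=> S S' SS' [x Lx Sx]; exists x => // y Ly xy; apply: SS'; exact: Sx.
have [U [UU sU]] := ultraFilterLemma final_proper.
have UI S S' : U S -> U S' -> U (fun x => S x /\ S' x) by exact: filterI.
(* [r u] is the colour of [(u, u')] for [U]-almost all [u'], and [i] below is the value of [r u] for
   [U]-almost all [u]. *)
have /choice[r hr] : forall u, exists i, U (fun u' => c [tuple u; u'] = i).
  by move=> u; exact: ultra_finite.
have [i hi] := ultra_finite r UU.
pose A u := L u /\ r u = i.
have UA : U A by apply: UI hi; apply: sU; exists x0.
have U_above t : L t -> U (le t) by move=> Lt; apply: sU; exists t.
apply: (@chain_finitely_many_types I T L T_order L_total L_down _ A _ _ _ k c hc).
- by move=> n v; exact: categorical_isolated.
- by move=> u [].
- by move=> t Lt; have /filter_ex[u []] := UI _ _ UA (U_above t Lt); exists u.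
- move=> u v t [Lu ru] [Lv rv] Lt ut.
  (* [U]-almost all [u'] lie in [A], above [t], and give colour [i] with [u]; almost all [v'] lie in
     [A] and give colour [i] with [v]. Equal colours mean equal pair types. *)
  have : U (fun u' => c [tuple u; u'] = i) by rewrite -ru; exact: hr.
  move=> /(UI _ _ (U_above t Lt))/(UI _ _ UA)/filter_ex[u' [Au' [tu' cu]]].
  have : U (fun v' => c [tuple v; v'] = i) by rewrite -rv; exact: hr.
  move=> /(UI _ _ UA)/filter_ex[v' [Av' cv]].
  by exists u', v'; split=> //; apply: hc; rewrite cu.
- by have /filter_ex[u] := UA; exists u.
Qed.
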